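(* Let $\xi_A$ be a conformal Killing spinor on a spin complex Riemannian manifold $(\mathcal M,g)$ of dimension six. Then $\xi_A$ satisfies $$(\nabla_a\xi^{bB})\xi_b{}^{C}+\big(\xi_a{}^{[B}\nabla_b\xi^{bC]}+\xi^{b[B}\nabla_b\xi_a{}^{C]}\big)-\tfrac23\,\xi^{bA}(\nabla_b\xi_A)\,\gamma_a{}^{BC}=0,$$ and thus also $$(\xi^{a(A}\nabla_a\xi^{bB)})\xi_b{}^{C}=0.$$
   Context: $(\mathcal M,g)$ is a six-dimensional complex manifold with a non-degenerate holomorphic section $g_{ab}$ of $\odot^2T^*\mathcal M$ (holomorphic metric), a holomorphic volume form and a holomorphic spin structure; $\nabla_a$ is its holomorphic Levi-Civita connection and the induced spin connection. All fields are holomorphic. In dimension six the two rank-$4$ chiral spinor bundles are dual to each other; write $\mathcal S=\mathcal S^-$ (upper indices $\zeta^A$) and $\mathcal S^*\cong\mathcal S^+$ (lower indices $\xi_A$). Clifford multiplication is given by ($\nabla$-parallel) skew $\gamma$-matrices $\gamma_a{}^{AB}=\gamma_a{}^{[AB]}$ and $\gamma_{aAB}=\gamma_{a[AB]}$ satisfying $\gamma_{(a}{}^{AC}\gamma_{b)CB}=-g_{ab}\delta^A_B$. Put $\xi_a{}^{B}:=\xi_A\gamma_a{}^{AB}$. Brackets denote normalised (skew-)symmetrisation. A conformal Killing spinor is a solution $\xi_A$ of $\nabla_a\xi_A+\frac1{\sqrt2}\gamma_{aBA}\zeta^B=0$ for some spinor field $\zeta^B$ (necessarily $\zeta^B=\frac{\sqrt2}{6}\gamma^{aAB}\nabla_a\xi_A$);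 equivalently, with $\nabla^{AB}=\nabla^{[AB]}$ the spinor form of $\nabla_a$ (obtained by contracting with $\gamma^{aAB}$ up to a constant factor), $\nabla^{AB}\xi_C+\frac23\delta^{[A}_C\nabla^{B]E}\xi_E=0$. *)

(* Defs.v *)
From mathcomp Require Import all_boot all_order all_algebra.
From mathcomp Require Import complex.
From mathcomp Require Import all_classical all_reals all_analysis.

Set Implicit Arguments.
Unset Strict Implicit.
Unset Printing Implicit Defensive.

Import Order.TTheory GRing.Theory Num.Theory numFieldNormedType.Exports.

Local Open Scope classical_set_scope.
Local Open Scope ring_scope.
Local Open Scope complex_scope.

(* R[i], declared as a numClosedFieldType so that the topology and the normed
   module structure that MathComp-Analysis puts on numeric fields are found.
   Differentiability over this field is complex differentiability, so a map
   differentiable at every point of an open set is holomorphic there. *)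
Definition Cplx (R : realType) : numClosedFieldType := R[i].

Definition holomorphic_on (R : realType) (n : nat)
    (W : normedModType (Cplx R)) (V : set 'rV[Cplx R]_n)
    (f : 'rV[Cplx R]_n -> W) : Prop :=
  forall x, V x -> differentiable f x.

Definition partial (R : realType) (n : nat) (a : 'I_n)
    (f : 'rV[Cplx R]_n -> Cplx R) (x : 'rV[Cplx R]_n) : Cplx R :=
  'D_(delta_mx 0 a) f x.

Record atlas (R : realType) (n : nat) := Atlas {
  carrier : topologicalType;
  chart_label : Type;
  chart_dom : chart_label -> set carrier;
  chart_map : chart_label -> carrier -> 'rV[Cplx R]_n;
  chart_inv : chart_label -> 'rV[Cplx R]_n -> carrier }.

Definition chart_image (R : realType) (n : nat) (M : atlas R n)
    (i : chart_label M) : set 'rV[Cplx R]_n :=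
  chart_map i @` chart_dom i.

(* The overlap of the domains of i and j, in the coordinates of i. *)
Definition overlap (R : realType) (n : nat) (M : atlas R n)
    (i j : chart_label M) : set 'rV[Cplx R]_n :=
  chart_map i @` (chart_dom i `&` chart_dom j).

Definition transition (R : realType) (n : nat) (M : atlas R n)
    (i j : chart_label M) (x : 'rV[Cplx R]_n) : 'rV[Cplx R]_n :=
  chart_map j (chart_inv i x).

(* The entry (a, b) of the jacobian of a map of row vectors is the partial
   derivative in direction a of the component b. *)
Definition jac (R : realType) (n : nat) (M : atlas R n)
    (i j : chart_label M) (x : 'rV[Cplx R]_n) : 'M[Cplx R]_n :=
  jacobian (transition i j) x.

Record is_complex_manifold (R : realType) (n : nat) (M : atlas R n) : Prop := {
  cm_hausdorff : hausdorff_space (carrier M);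
  cm_second_countable : @second_countable (carrier M);
  cm_dom_open : forall i : chart_label M, open (chart_dom i);
  cm_cover : forall p : carrier M, exists i : chart_label M, chart_dom i p;
  cm_image_open : forall i : chart_label M, open (chart_image i);
  cm_chartK : forall (i : chart_label M) p,
    chart_dom i p -> chart_inv i (chart_map i p) = p;
  cm_chart_continuous : forall i : chart_label M,
    {within chart_dom i, continuous (@chart_map _ _ M i)};
  cm_inv_continuous : forall i : chart_label M,
    {within chart_image i, continuous (@chart_inv _ _ M i)};
  cm_transition_holomorphic : forall i j : chart_label M,
    holomorphic_on (overlap i j) (transition i j) }.

(* Tensor and spinor fields are given by their components in every chart:
   for each chart, one function of the coordinates per value of the indices.
   The rank-4 bundle S is trivialised over the chart domains, which is no
   restriction because the atlas need not be maximal and can be refined. *)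
Record spin_geometry (R : realType) := SpinGeometry {
  base_manifold : atlas R 6;
  metric : chart_label base_manifold ->
    'I_6 -> 'I_6 -> 'rV[Cplx R]_6 -> Cplx R;
  volume : chart_label base_manifold -> 'rV[Cplx R]_6 -> Cplx R;
  (* spinor_transition i j A B: the components xi_A of a section of S^* in the
     frame of i are obtained from those in the frame of j by applying this
     matrix (row A, column B); see [is_cospinor_field]. *)
  spinor_transition : chart_label base_manifold -> chart_label base_manifold ->
    'I_4 -> 'I_4 -> 'rV[Cplx R]_6 -> Cplx R;
  gamma_up : chart_label base_manifold ->
    'I_6 -> 'I_4 -> 'I_4 -> 'rV[Cplx R]_6 -> Cplx R;
  gamma_dn : chart_label base_manifold ->
    'I_6 -> 'I_4 -> 'I_4 -> 'rV[Cplx R]_6 -> Cplx R;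
  (* spin_conn i a A B is omega_{a A}^B, where
     nabla_a xi_A = d_a xi_A - omega_{a A}^B xi_B. *)
  spin_conn : chart_label base_manifold ->
    'I_6 -> 'I_4 -> 'I_4 -> 'rV[Cplx R]_6 -> Cplx R }.

Section SpinGeometry.

Variables (R : realType) (G : spin_geometry R).

Local Notation C := (Cplx R).
Local Notation X := 'rV[C]_6.
Local Notation label := (chart_label (base_manifold G)).

Record is_holomorphic_metric : Prop := {
  hm_holomorphic : forall (i : label) a b,
    holomorphic_on (chart_image i) (metric i a b);
  hm_sym : forall (i : label) a b x, chart_image i x ->
    metric i a b x = metric i b a x;
  hm_nondegenerate : forall (i : label) x, chart_image i x ->
    (\matrix_(a, b) metric i a b x) \in unitmx;
  hm_glue : forall (i j : label) a b x, overlap i j x ->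
    metric i a b x = \sum_c \sum_d
      jac i j x a c * jac i j x b d * metric j c d (transition i j x) }.

(* volume i is the component of the 6-form on dx^1 /\ ... /\ dx^6. *)
Record is_volume_form : Prop := {
  vf_holomorphic : forall i : label,
    holomorphic_on (chart_image i) (volume i);
  vf_neq0 : forall (i : label) x, chart_image i x -> volume i x != 0;
  vf_glue : forall (i j : label) x, overlap i j x ->
    volume i x = \det (jac i j x) * volume j (transition i j x) }.

Definition inv_metric (i : label) (a b : 'I_6) (x : X) : C :=
  invmx (\matrix_(c, d) metric i c d x) a b.

(* christoffel i a b c is Gamma_{a b}^c of the Levi-Civita connection. *)
Definition christoffel (i : label) (a b c : 'I_6) (x : X) : C :=
  2^-1 * \sum_d inv_metric i c d x *
    (partial a (metric i b d) x + partial b (metric i a d) x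
     - partial d (metric i a b) x).

(* The covariant derivatives below are named after the indices of the field
   that is differentiated: v for a vector index and s for a spinor
   index, each followed by u (upper) or d (lower).  The first 'I_6 argument
   is always the index of nabla. *)
Definition nabla_sd (i : label) (xi : 'I_4 -> X -> C)
    (a : 'I_6) (A : 'I_4) (x : X) : C :=
  partial a (xi A) x - \sum_B spin_conn i a A B x * xi B x.

Definition nabla_vu_su (i : label) (phi : 'I_6 -> 'I_4 -> X -> C)
    (a b : 'I_6) (B : 'I_4) (x : X) : C :=
  partial a (phi b B) x + \sum_c christoffel i a c b x * phi c B x
  + \sum_D spin_conn i a D B x * phi b D x.

Definition nabla_vd_su (i : label) (phi : 'I_6 -> 'I_4 -> X -> C)
    (a b : 'I_6) (B : 'I_4) (x : X) : C :=
  partial a (phi b B) x - \sum_c christoffel i a b c x * phi c B x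
  + \sum_D spin_conn i a D B x * phi b D x.

Definition nabla_vd_su_su (i : label)
    (phi : 'I_6 -> 'I_4 -> 'I_4 -> X -> C)
    (a b : 'I_6) (A B : 'I_4) (x : X) : C :=
  partial a (phi b A B) x - \sum_c christoffel i a b c x * phi c A B x
  + \sum_D spin_conn i a D A x * phi b D B x
  + \sum_D spin_conn i a D B x * phi b A D x.

Definition nabla_vd_sd_sd (i : label)
    (phi : 'I_6 -> 'I_4 -> 'I_4 -> X -> C)
    (a b : 'I_6) (A B : 'I_4) (x : X) : C :=
  partial a (phi b A B) x - \sum_c christoffel i a b c x * phi c A B x
  - \sum_D spin_conn i a A D x * phi b D B x
  - \sum_D spin_conn i a B D x * phi b A D x.

Record is_spinor_cocycle : Prop := {
  sc_holomorphic : forall (i j : label) A B,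
    holomorphic_on (overlap i j) (spinor_transition i j A B);
  sc_id : forall (i : label) A B x, chart_image i x ->
    spinor_transition i i A B x = (A == B)%:R;
  sc_cocycle : forall (i j k : label) A B x,
    overlap i j x -> overlap i k x ->
    spinor_transition i k A B x = \sum_D
      spinor_transition i j A D x * spinor_transition j k D B (transition i j x)
  }.

(* Such gamma-matrices make S a spin structure: the pairs in GL(6) x GL(4)
   that preserve both gamma_up and gamma_dn form the group SL(4) = Spin(6),
   which acts on vectors through SO(6). *)
Record is_clifford : Prop := {
  cl_up_holomorphic : forall (i : label) a A B,
    holomorphic_on (chart_image i) (gamma_up i a A B);
  cl_dn_holomorphic : forall (i : label) a A B,
    holomorphic_on (chart_image i) (gamma_dn i a A B);
  cl_up_skew : forall (i : label) a A B x, chart_image i x ->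
    gamma_up i a A B x = - gamma_up i a B A x;
  cl_dn_skew : forall (i : label) a A B x, chart_image i x ->
    gamma_dn i a A B x = - gamma_dn i a B A x;
  cl_up_glue : forall (i j : label) a D E x, overlap i j x ->
    \sum_b jac i j x a b * gamma_up j b D E (transition i j x) =
    \sum_A \sum_B gamma_up i a A B x *
      spinor_transition i j A D x * spinor_transition i j B E x;
  cl_dn_glue : forall (i j : label) a A B x, overlap i j x ->
    gamma_dn i a A B x = \sum_b \sum_D \sum_E
      jac i j x a b * spinor_transition i j A D x *
      spinor_transition i j B E x * gamma_dn j b D E (transition i j x);
  cl_clifford : forall (i : label) a b A B x, chart_image i x ->
    2^-1 * \sum_D (gamma_up i a A D x * gamma_dn i b D B x +
                   gamma_up i b A D x * gamma_dn i a D B x) =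
    - metric i a b x * (A == B)%:R }.

(* The spin connection induced by the Levi-Civita connection: the gamma_up a
   span the skew forms, so at most one connection on S makes them parallel. *)
Record is_spin_connection : Prop := {
  sp_holomorphic : forall (i : label) a A B,
    holomorphic_on (chart_image i) (spin_conn i a A B);
  sp_glue : forall (i j : label) a A D x, overlap i j x ->
    \sum_B spin_conn i a A B x * spinor_transition i j B D x =
    partial a (spinor_transition i j A D) x
    + \sum_b \sum_B jac i j x a b * spinor_transition i j A B x *
        spin_conn j b B D (transition i j x);
  sp_up_parallel : forall (i : label) a b A B x, chart_image i x ->
    nabla_vd_su_su i (gamma_up i) a b A B x = 0;
  sp_dn_parallel : forall (i : label) a b A B x, chart_image i x ->
    nabla_vd_sd_sd i (gamma_dn i) a b A B x = 0 }.

Record is_spin_complex_riemannian : Prop := {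
  scr_manifold : is_complex_manifold (base_manifold G);
  scr_metric : is_holomorphic_metric;
  scr_volume : is_volume_form;
  scr_cocycle : is_spinor_cocycle;
  scr_clifford : is_clifford;
  scr_connection : is_spin_connection }.

(* Sections xi_A of S^*. *)
Record is_cospinor_field (xi : label -> 'I_4 -> X -> C) : Prop := {
  cs_holomorphic : forall (i : label) A,
    holomorphic_on (chart_image i) (xi i A);
  cs_glue : forall (i j : label) A x, overlap i j x ->
    xi i A x = \sum_B spinor_transition i j A B x * xi j B (transition i j x) }.

(* Sections zeta^A of S. *)
Record is_spinor_field (zeta : label -> 'I_4 -> X -> C) : Prop := {
  sf_holomorphic : forall (i : label) A,
    holomorphic_on (chart_image i) (zeta i A);
  sf_glue : forall (i j : label) B x, overlap i j x ->
    zeta j B (transition i j x) =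
    \sum_A zeta i A x * spinor_transition i j A B x }.

Definition conformal_killing_spinor
    (xi : label -> 'I_4 -> X -> C) : Prop :=
  is_cospinor_field xi /\
  exists2 zeta : label -> 'I_4 -> X -> C, is_spinor_field zeta &
    forall (i : label) a A x, chart_image i x ->
      nabla_sd i (xi i) a A x
      + (sqrtC 2)^-1 * \sum_B gamma_dn i a B A x * zeta i B x = 0.

(* xi_a^B and xi^{a B}. *)
Definition xi_vd (i : label) (xi : 'I_4 -> X -> C)
    (a : 'I_6) (B : 'I_4) (x : X) : C :=
  \sum_A xi A x * gamma_up i a A B x.

Definition xi_vu (i : label) (xi : 'I_4 -> X -> C)
    (a : 'I_6) (B : 'I_4) (x : X) : C :=
  \sum_b inv_metric i a b x * xi_vd i xi b B x.

End SpinGeometry.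

Definition sym_part (R : realType) (T : 'I_4 -> 'I_4 -> Cplx R)
    (A B : 'I_4) : Cplx R := 2^-1 * (T A B + T B A).

Definition skew_part (R : realType) (T : 'I_4 -> 'I_4 -> Cplx R)
    (A B : 'I_4) : Cplx R := 2^-1 * (T A B - T B A).

(* Main.v *)
Require Import Defs.
From mathcomp Require Import all_boot all_order all_algebra.
From mathcomp Require Import complex.
From mathcomp Require Import all_classical all_reals all_analysis.
From mathcomp Require Import ring.
Import Order.TTheory GRing.Theory Num.Theory numFieldNormedType.Exports.
Local Open Scope ring_scope.

Set Implicit Arguments.
Unset Strict Implicit.
Unset Printing Implicit Defensive.

(* Write U_a, L_a for the skew matrices of gamma_a^{AB} and gamma_{aAB}, h for
   the inverse metric and s = 1 / sqrt 2.  Since the metric, the gamma-matrices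
   and hence the contraction with them are parallel, every derivative in the
   identity is built from nabla_a xi = - s zeta L_a (row vectors), and the
   identity becomes pointwise algebra.  That algebra rests on two consequences
   of the Clifford relation: the completeness relation
     h^{ab} L_{aAB} U_b^{CD} = 2 (delta_A^C delta_B^D - delta_A^D delta_B^C),
   which holds because tr (U_a L_b) = - 4 g_ab makes the six U_a and the six
   L_a dual bases of skew forms, and the total skewness of
   h^{ab} U_a^{AB} U_b^{CD}.  The first identity follows from completeness; by
   it the symmetrised expression of the second one only contains contractions
   of the totally skew tensor with a symmetric pair of indices. *)

Lemma symE (F : Type) n (A : 'M[F]_n) i j : A^T = A -> A i j = A j i.
Proof. by move=> s; rewrite -[in LHS]s mxE. Qed.

(** * Contraction with the inverse metric *)

Section Contraction.
Variables (F : fieldType) (n : nat) (g : 'M[F]_n).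

(** The values lie in an arbitrary module, so rows and matrices of every format share the same
    lemmas, and any linear map commutes with the contraction. *)
Definition contract (V : lmodType F) (f : 'I_n -> 'I_n -> V) : V :=
  \sum_a \sum_b invmx g a b *: f a b.

Lemma eq_contract (V : lmodType F) (f1 f2 : 'I_n -> 'I_n -> V) :
  (forall a b, f1 a b = f2 a b) -> contract f1 = contract f2.
Proof. by move=> E; do 2![apply: eq_bigr => ? _]; rewrite E. Qed.

Lemma contractD (V : lmodType F) (f1 f2 : 'I_n -> 'I_n -> V) :
  contract (fun a b => f1 a b + f2 a b) = contract f1 + contract f2.
Proof.
rewrite /contract -big_split; apply: eq_bigr => a _ /=.
by rewrite -big_split; apply: eq_bigr => b _; rewrite scalerDr.
Qed.

Lemma contract_linear (V W : lmodType F) (u : {linear V -> W})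
    (f : 'I_n -> 'I_n -> V) :
  u (contract f) = contract (fun a b => u (f a b)).
Proof.
rewrite /contract raddf_sum; apply: eq_bigr => a _; rewrite raddf_sum.
apply: eq_bigr => b _.
exact: linearZZ.
Qed.

Lemma contractN (V : lmodType F) (f : 'I_n -> 'I_n -> V) :
  contract (fun a b => - f a b) = - contract f.
Proof. by rewrite (contract_linear (@GRing.opp V)). Qed.

Lemma contractZ (V : lmodType F) k (f : 'I_n -> 'I_n -> V) :
  contract (fun a b => k *: f a b) = k *: contract f.
Proof. by rewrite (contract_linear ( *:%R k)). Qed.

Lemma contract_mull p q r (A : 'M[F]_(p, q)) (f : 'I_n -> 'I_n -> 'M[F]_(q, r)) :
  contract (fun a b => A *m f a b) = A *m contract f.
Proof. by rewrite (contract_linear (mulmx A)). Qed.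

Lemma contract_mulr p q r (f : 'I_n -> 'I_n -> 'M[F]_(p, q)) (B : 'M[F]_(q, r)) :
  contract (fun a b => f a b *m B) = contract f *m B.
Proof. exact: esym (contract_linear (mulmxr B) f). Qed.

Lemma contractE p q (f : 'I_n -> 'I_n -> 'M[F]_(p, q)) i j :
  contract f i j = \sum_a \sum_b invmx g a b * f a b i j.
Proof.
rewrite summxE; apply: eq_bigr => a _.
by rewrite summxE; apply: eq_bigr => b _; rewrite mxE.
Qed.

Hypothesis g_sym : g^T = g.

Lemma invmx_sym a b : invmx g a b = invmx g b a.
Proof. by apply: symE; rewrite trmx_inv g_sym. Qed.

Lemma contract_sym (V : lmodType F) (f : 'I_n -> 'I_n -> V) :
  contract f = contract (fun a b => f b a).
Proof.
rewrite /contract exchange_big /=.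
by apply: eq_bigr => a _; apply: eq_bigr => b _; rewrite invmx_sym.
Qed.

Hypothesis g_unit : g \in unitmx.

(** Since h^{ab} g_{ac} = delta^b_c, this collapses the metric terms that each use of the Clifford
    relation produces. *)
Lemma contract_metric (V : lmodType F) (f : 'I_n -> V) c :
  contract (fun a b => g a c *: f b) = f c.
Proof.
rewrite contract_sym /contract.
under eq_bigr => a _ do
  (under eq_bigr => b _ do rewrite scalerA; rewrite -scaler_suml).
have E a : \sum_b invmx g a b * g b c = (a == c)%:R.
  by have := mulVmx g_unit => /matrixP /(_ a c); rewrite !mxE.
rewrite (bigD1 c) //= E eqxx scale1r big1 ?addr0 // => a /negbTE.
by rewrite E => ->; rewrite scale0r.
Qed.

Lemma contract_gg (V : lmodType F) (v : V) :
  contract (fun a b => g a b *: v) = n%:R *: v.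
Proof.
rewrite /contract.
transitivity (\sum_(a < n) v); last by rewrite sumr_const card_ord scaler_nat.
apply: eq_bigr => a _.
under eq_bigr => b _ do rewrite scalerA.
rewrite -scaler_suml (_ : \sum_b _ = 1) ?scale1r //.
have := mulVmx g_unit => /matrixP /(_ a a); rewrite !mxE eqxx => E.
by apply: etrans E; apply: eq_bigr => b _; rewrite (symE _ _ g_sym).
Qed.

End Contraction.

(** * Skew forms on a four-dimensional space *)

Section SkewPairs.
Variable F : fieldType.

(** Together with [pair_snd], this lists the increasing pairs in lexicographic order: the six
    coordinates of a skew form, as many as there are gamma-matrices. *)
Definition pair_fst (k : 'I_6) : 'I_4 := inord (nth 0 [:: 0; 0; 0; 1; 1; 2] k)%N.
Definition pair_snd (k : 'I_6) : 'I_4 := inord (nth 0 [:: 1; 2; 3; 2; 3; 3] k)%N.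

(** Reduces an identity that is skew in A, B to the six increasing pairs. *)
Lemma pair_cases (A B : 'I_4) :
  A = B \/ exists k, (A, B) = (pair_fst k, pair_snd k) \/
                     (A, B) = (pair_snd k, pair_fst k).
Proof.
case: (ltngtP A B) => [AB|AB|/val_inj]; [right|right|by left].
- suff [k kE] : exists k, (A, B) = (pair_fst k, pair_snd k) by exists k; left.
  move: A B AB; do 2!case=> -[|[|[|[|//]]]] ?; rewrite //= => _;
    [exists (inord 0)|exists (inord 1)|exists (inord 2)|exists (inord 3)
    |exists (inord 4)|exists (inord 5)];
    by congr pair; apply: val_inj; rewrite /pair_fst /pair_snd /= !inordK.
- suff [k kE] : exists k, (B, A) = (pair_fst k, pair_snd k).
    by exists k; right; case: kE => -> ->.
  move: A B AB; do 2!case=> -[|[|[|[|//]]]] ?; rewrite //= => _;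
    [exists (inord 0)|exists (inord 1)|exists (inord 3)|exists (inord 2)
    |exists (inord 4)|exists (inord 5)];
    by congr pair; apply: val_inj; rewrite /pair_fst /pair_snd /= !inordK.
Qed.

Lemma pair_lt k : (pair_fst k < pair_snd k)%N.
Proof.
by case: k => -[|[|[|[|[|[|//]]]]]] ?; rewrite /pair_fst /pair_snd /= !inordK.
Qed.

Lemma pair_inj k l :
  (pair_fst k == pair_fst l) && (pair_snd k == pair_snd l) = (k == l).
Proof.
rewrite -!val_eqE.
by case: k l => -[|[|[|[|[|[|//]]]]]] ? [] [|[|[|[|[|[|//]]]]]] ?;
  rewrite /pair_fst /pair_snd /= !inordK.
Qed.

(** Both pairs are increasing, so the crossed product of Kronecker deltas never contributes. *)
Lemma pair_swap k l :
  (pair_fst k == pair_snd l) && (pair_snd k == pair_fst l) = false.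
Proof.
apply/negP => /andP [/eqP E1 /eqP E2].
by have := pair_lt k; rewrite E1 E2 ltnNge ltnW ?pair_lt.
Qed.

End SkewPairs.

Section SkewMatrices.
Variable F : numFieldType.

Lemma oppr_self (x : F) : x = - x -> x = 0.
Proof. by move/eqP; rewrite -addr_eq0 -mulr2n mulrn_eq0 => /eqP. Qed.

Lemma skewE (M : 'M[F]_4) A B : M^T = - M -> M A B = - M B A.
Proof. by move/matrixP/(_ B A); rewrite !mxE. Qed.

Lemma skew_diag (M : 'M[F]_4) A : M^T = - M -> M A A = 0.
Proof. by move=> /(skewE A A) /oppr_self. Qed.

(** The diagonals vanish, and each of the six pairs occurs twice in the trace with M_{AB} N_{BA} = -
    M_{AB} N_{AB}. *)
Lemma mxtrace_skew (M N : 'M[F]_4) : M^T = - M -> N^T = - N ->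
  \tr (M *m N) =
  - 2 * \sum_k M (pair_fst k) (pair_snd k) * N (pair_fst k) (pair_snd k).
Proof.
move=> Ms Ns; rewrite /mxtrace.
pose o (k : nat) : 'I_4 := inord k.
(* Over a range of natural numbers the sums unfold to explicit terms. *)
have sum_inord n (f : 'I_n.+1 -> F) :
    \sum_k f k = \sum_(0 <= k < n.+1) f (inord k).
  by rewrite big_mkord; apply: eq_bigr => k _; rewrite inord_val.
under eq_bigr => i _ do rewrite mxE sum_inord.
rewrite !sum_inord !unlock /= /pair_fst /pair_snd !inordK //=.
rewrite -/(o 0%N) -/(o 1%N) -/(o 2) -/(o 3).
rewrite !(skew_diag _ Ms) (skewE (o 1%N) (o 0%N) Ms) (skewE (o 2) (o 0%N) Ms).
rewrite (skewE (o 3) (o 0%N) Ms) (skewE (o 2) (o 1%N) Ms) (skewE (o 3) (o 1%N) Ms).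
rewrite (skewE (o 3) (o 2) Ms).
rewrite !(skew_diag _ Ns) (skewE (o 1%N) (o 0%N) Ns) (skewE (o 2) (o 0%N) Ns).
rewrite (skewE (o 3) (o 0%N) Ns) (skewE (o 2) (o 1%N) Ns) (skewE (o 3) (o 1%N) Ns).
rewrite (skewE (o 3) (o 2) Ns).
ring.
Qed.

End SkewMatrices.

(** * Chiral gamma-matrices in dimension six *)

Section ChiralClifford.
Variables (F : numFieldType) (g : 'M[F]_6) (U L : 'I_6 -> 'M[F]_4).
Hypothesis g_unit : g \in unitmx.
Hypothesis g_sym : g^T = g.
Hypothesis U_skew : forall a, (U a)^T = - U a.
Hypothesis L_skew : forall a, (L a)^T = - L a.
Hypothesis clifford : forall a b, U a *m L b + U b *m L a = (- 2 * g a b)%:M.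

Local Notation contract := (contract g).

Lemma UL_swap a b : U a *m L b = (- 2 * g a b)%:M - U b *m L a.
Proof. by rewrite -clifford addrK. Qed.

(** The transpose of [UL_swap]: the two signs of skewness cancel, so (L_a U_b)^T = U_b L_a. *)
Lemma LU_swap a b : L a *m U b = (- 2 * g a b)%:M - L b *m U a.
Proof.
apply: trmx_inj; rewrite linearB /= !trmx_mul tr_scalar_mx !U_skew !L_skew.
by rewrite !mulNmx !mulmxN !opprK UL_swap (symE _ _ g_sym).
Qed.

(** As h is symmetric, twice the contraction is that of f_{ab} + f_{ba} = - 2 g_{ab}, and h^{ab}
    g_{ab} = 6. *)
Lemma contract_swap (f : 'I_6 -> 'I_6 -> 'M[F]_4) :
  (forall a b, f a b = (- 2 * g a b)%:M - f b a) -> contract f = (- 6)%:M.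
Proof.
move=> fE; apply: (@scalerI _ _ (2 : F)); first by rewrite pnatr_eq0.
rewrite scaler_nat mulr2n {2}(contract_sym g_sym) -contractD.
transitivity (contract (fun a b => g a b *: (- 2)%:M : 'M[F]_4)).
  by apply: eq_contract => a b; rewrite fE subrK scale_scalar_mx mulrC.
by rewrite contract_gg // !scale_scalar_mx; congr (_%:M); ring.
Qed.

Lemma contract_UL : contract (fun a b => U a *m L b) = (- 6)%:M.
Proof. exact/contract_swap/UL_swap. Qed.

Lemma contract_LU : contract (fun a b => L a *m U b) = (- 6)%:M.
Proof. exact/contract_swap/LU_swap. Qed.

Lemma mxtrace_contract m (f : 'I_6 -> 'I_6 -> 'M[F]_m) :
  \tr (contract f) = \sum_a \sum_b invmx g a b * \tr (f a b).
Proof.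
rewrite raddf_sum; apply: eq_bigr => a _; rewrite raddf_sum.
by apply: eq_bigr => b _; exact: mxtraceZ.
Qed.

(* Contract [U_a L_b U_c L_d] over [c, d], directly and after moving [U_c] to
   the front, and take traces. *)
Lemma mxtrace_UL_sym a b : \tr (U a *m L b) = \tr (U b *m L a).
Proof.
have E : contract (fun c d => U a *m L b *m (U c *m L d)) =
    contract (fun c d => (U c *m L a) *m (U b *m L d))
    + (2 *: (U b *m L a) - 2 *: (U a *m L b)).
  rewrite -(contract_metric g_sym g_unit (fun d => 2 *: (U b *m L d)) a).
  rewrite -(contract_metric g_sym g_unit (fun d => 2 *: (U a *m L d)) b).
  rewrite -contractN -!contractD; apply: eq_contract => c d.
  rewrite -mulmxA (mulmxA (L b)) LU_swap mulmxBl mulmxBr mul_scalar_mx.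
  rewrite -(mulmxA (L c)) (mulmxA (U a) (L c)) (UL_swap a c) mulmxBl mul_scalar_mx.
  rewrite -scalemxAr !scalerA (symE b c g_sym) (symE a c g_sym) opprB.
  by rewrite !(mulrC _ 2) !mulNr !scaleNr opprK addrC -!addrA.
move/(congr1 mxtrace): E; rewrite contract_mull contract_UL mxtraceD.
(* Cyclicity of the trace brings L_d next to U_c, and their contraction is - 6. With t and t' the
   traces of U_a L_b and U_b L_a, what remains is - 6 t = - 6 t' + 2 t' - 2 t, hence 4 t = 4 t'. *)
have -> : \tr (contract (fun c d => U c *m L a *m (U b *m L d))) =
    \tr (- 6 *: (L a *m U b)).
  rewrite -mul_scalar_mx -contract_LU -contract_mulr !mxtrace_contract.
  rewrite exchange_big; apply: eq_bigr => d _; apply: eq_bigr => c _ /=.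
  by rewrite (invmx_sym g_sym) [U c *m _ *m _]mulmxA mxtrace_mulC !mulmxA.
rewrite mul_mx_scalar mxtraceD raddfN /= !mxtraceZ.
rewrite [\tr (L a *m U b)]mxtrace_mulC => E.
apply: (@mulfI _ 4); first by rewrite pnatr_eq0.
set t := \tr _ in E *; set t' := \tr _ in E *.
rewrite (_ : 4 * t = - 2 * t - (- 6 * t)); last by ring.
by rewrite E; ring.
Qed.

(** By [mxtrace_UL_sym] both terms of the Clifford relation have the same trace, and the scalar
    matrix on its right has trace 4 (- 2 g_{ab}). *)
Lemma mxtrace_UL a b : \tr (U a *m L b) = - 4 * g a b.
Proof.
have /(congr1 mxtrace) := clifford a b.
rewrite mxtraceD -mxtrace_UL_sym mxtrace_scalar => E.
apply: (@mulfI _ 2); first by rewrite pnatr_eq0.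
by rewrite mulr2n mulrDl mul1r E -mulr_natr; ring.
Qed.

(* Both families have six members and are dual to each other for the pairing of
   skew forms, hence they are bases of the six-dimensional space of skew forms. *)
Lemma pair_complete k l :
  \sum_a \sum_b invmx g a b * L a (pair_fst k) (pair_snd k) *
     U b (pair_fst l) (pair_snd l) = 2 * (k == l)%:R.
Proof.
pose X := \matrix_(b, l) U b (pair_fst l) (pair_snd l).
pose Y := \matrix_(k, a) L a (pair_fst k) (pair_snd k).
have n2 : (2 : F) != 0 by rewrite pnatr_eq0.
have XY : X *m Y = 2 *: g.
  apply/matrixP => a b; rewrite !mxE.
  under eq_bigr => i _ do rewrite !mxE.
  apply: (@mulfI _ (- 2)); first by rewrite oppr_eq0 pnatr_eq0.
  by rewrite -mxtrace_skew // mxtrace_UL; ring.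
have: (2^-1 *: X) *m (Y *m invmx g) = 1%:M.
  by rewrite -scalemxAl mulmxA XY -scalemxAl mulmxV // scalerA mulVf ?scale1r.
(* The matrices are square of size six, so a one-sided inverse is two-sided; the product in the
   other order is the claim. *)
move/mulmx1C; rewrite -scalemxAr => /(congr1 ( *:%R 2)).
rewrite scalerA mulfV // scale1r => /matrixP /(_ k l).
rewrite !mxE => <-; rewrite exchange_big; apply: eq_bigr => b _ /=.
rewrite !mxE mulr_suml; apply: eq_bigr => a _; rewrite !mxE; ring.
Qed.

(** Both sides are skew in A, B and in C, D, which leaves increasing pairs, where [pair_complete]
    applies. *)
Lemma gamma_complete A B C D :
  \sum_a \sum_b invmx g a b * L a A B * U b C D =
  2 * (((A == C) && (B == D))%:R - ((A == D) && (B == C))%:R).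
Proof.
pose E A B C D := \sum_a \sum_b invmx g a b * L a A B * U b C D.
have El A' B' C' D' : E A' B' C' D' = - E B' A' C' D'.
  rewrite /E -sumrN; apply: eq_bigr => a _; rewrite -sumrN.
  by apply: eq_bigr => b _; rewrite (skewE A' B' (L_skew a)) mulrN mulNr.
have Er A' B' C' D' : E A' B' C' D' = - E A' B' D' C'.
  rewrite /E -sumrN; apply: eq_bigr => a _; rewrite -sumrN.
  by apply: eq_bigr => b _; rewrite (skewE C' D' (U_skew b)) mulrN.
rewrite -/(E A B C D).
have [->|[k kE]] := pair_cases A B.
  rewrite [X in _ - X](_ : _ = ((B == C) && (B == D))%:R); last by rewrite andbC.
  rewrite subrr mulr0; exact/oppr_self/El.
have [->|[l lE]] := pair_cases C D.
  rewrite subrr mulr0; exact/oppr_self/Er.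
have Ekl := pair_complete k l; rewrite -/(E _ _ _ _) in Ekl.
have sw := pair_swap k l; have sw' := pair_swap l k.
rewrite ![pair_fst l == _]eq_sym ![pair_snd l == _]eq_sym andbC in sw'.
by case: kE lE => -[-> ->] [] [-> ->];
  rewrite ?[E (pair_snd k) _ _ _]El ?[E _ _ (pair_snd l) _]Er;
  rewrite Ekl -(pair_inj k l) ?sw ?sw'
   ?[(pair_snd k == _) && _]andbC ?sw ?sw' ?subr0 ?sub0r ?mulrN ?opprK.
Qed.

(** Completeness summed against M^{BC}: the term delta_A^C delta_B^D gives the transpose, the term
    delta_A^D delta_B^C the trace. *)
Lemma contract_LMU (M : 'M[F]_4) :
  contract (fun a b => L a *m M *m U b) = 2 *: (M^T - (\tr M)%:M).
Proof.
apply/matrixP => A D; rewrite contractE !mxE.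
transitivity (\sum_B \sum_C M B C *
    \sum_a \sum_b invmx g a b * L a A B * U b C D).
  under [RHS]eq_bigr => B _ do
    (under eq_bigr => C _ do
       (rewrite mulr_sumr; under eq_bigr => a _ do rewrite mulr_sumr);
     rewrite exchange_big; under eq_bigr => a _ do rewrite exchange_big).
  rewrite [RHS]exchange_big; apply: eq_bigr => a _ /=.
  rewrite [RHS]exchange_big; apply: eq_bigr => b _ /=.
  rewrite mxE mulr_sumr [RHS]exchange_big; apply: eq_bigr => C _ /=.
  rewrite mxE mulr_suml mulr_sumr; apply: eq_bigr => B _; ring.
under eq_bigr => B _ do
  (under eq_bigr => C _ do rewrite gamma_complete mulrCA mulrBr;
   rewrite -mulr_sumr sumrB).
rewrite -mulr_sumr sumrB; congr (_ * (_ - _)).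
  rewrite (bigD1 D) //= (bigD1 A) //= !eqxx mulr1 big1 ?addr0 => [|C /negbTE].
    rewrite big1 ?addr0 // => B /negbTE BD; apply: big1 => C _.
    by rewrite BD andbF mulr0.
  by rewrite eq_sym => ->; rewrite mulr0.
rewrite -mulr_natr mulr_suml; apply: eq_bigr => B _.
rewrite (bigD1 B) //= eqxx andbT big1 ?addr0 // => C /negbTE.
by rewrite eq_sym => ->; rewrite andbF mulr0.
Qed.

(** Follows from [contract_LMU] by transposition, as (U_a M L_b)^T = L_b M^T U_a. *)
Lemma contract_UML (M : 'M[F]_4) :
  contract (fun a b => U a *m M *m L b) = 2 *: (M^T - (\tr M)%:M).
Proof.
apply: trmx_inj; rewrite (contract_linear _ trmx) (contract_sym g_sym).
rewrite linearZ linearB /= tr_scalar_mx -mxtrace_tr -contract_LMU.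
apply: eq_contract => a b.
by rewrite !trmx_mul U_skew L_skew mulNmx mulmxN mulmxN opprK mulmxA.
Qed.

(* The contraction [K] satisfies [K L_e = 0] for all [e], and
   [K L_e U_f] contracts to [- 6 K]. *)
Lemma contract_USU (S : 'M[F]_4) : S^T = S ->
  contract (fun a b => U a *m S *m U b) = 0.
Proof.
move=> Ssym; set K := LHS.
have KL e : K *m L e = 0.
  have -> : K *m L e = contract (fun a b => g b e *: (- 2 *: (U a *m S)))
      - contract (fun a b => U a *m (S *m U e) *m L b).
    rewrite /K -contract_mulr -contractN -contractD; apply: eq_contract => a b.
    rewrite -(mulmxA (U a *m S)) UL_swap mulmxBr mul_mx_scalar !mulmxA scalerA.
    by rewrite mulrC.
  (* The first contraction is - 2 U_e S. The second is 2 (S U_e)^T = - 2 U_e S, because the product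
     of a symmetric and a skew matrix has trace zero. *)
  rewrite (contract_sym g_sym).
  rewrite (contract_metric g_sym g_unit (fun a => - 2 *: (U a *m S))).
  rewrite contract_UML trmx_mul U_skew Ssym.
  have -> : \tr (S *m U e) = 0.
    apply: oppr_self; rewrite -[LHS]mxtrace_tr trmx_mul U_skew Ssym.
    by rewrite mulNmx raddfN mxtrace_mulC.
  by rewrite raddf0 subr0 mulNmx scalerN scaleNr opprK addNr.
have: K *m contract (fun a b => L a *m U b) = 0.
  rewrite -contract_mull; apply: big1 => a _; apply: big1 => b _.
  by rewrite mulmxA KL mul0mx scaler0.
rewrite contract_LU mul_mx_scalar => /eqP; rewrite scaler_eq0 oppr_eq0 pnatr_eq0 /=.
by move/eqP.
Qed.

(** [contract_USU] for an elementary symmetric matrix gives skewness in the two middle indices; with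
    the skewness of each U_a this is total skewness. *)
Lemma gamma_skew A B C D :
  \sum_a \sum_b invmx g a b * (U a A B * U b C D + U a A C * U b B D) = 0.
Proof.
pose S := delta_mx B C + delta_mx C B : 'M[F]_4.
have Ssym : S^T = S by rewrite linearD /= !trmx_delta addrC.
have /matrixP /(_ A D) := contract_USU Ssym; rewrite contractE [RHS]mxE => E0.
apply: etrans E0; apply: eq_bigr => a _; apply: eq_bigr => b _; congr (_ * _).
rewrite mulmxDr mulmxDl mxE.
have E B' C' : (U a *m delta_mx B' C' *m U b) A D = U a A B' * U b C' D.
  rewrite mxE (bigD1 C') //= mxE (bigD1 B') //= mxE !eqxx mulr1.
  rewrite !big1 ?addr0 // => i /negbTE iE; rewrite !mxE ?iE ?mulr0 //.
  rewrite big1 ?mul0r // => j _; by rewrite !mxE iE andbF mulr0.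
by rewrite !E.
Qed.

(** * Contractions of a cospinor with its gradient at a point *)

Section CoSpinor.
(* [x] is the value of [xi_A], and the conformal Killing equation gives
   [nabla_a xi_A] the value [- s *: (z *m L a)], [z] being that of [zeta^A]. *)
Variables (x z : 'rV[F]_4) (s : F).

Let dx a : 'rV[F]_4 := - s *: (z *m L a).

Lemma tr_outer (v w : 'rV[F]_4) : \tr (v^T *m w) = (w *m v^T) 0 0.
Proof. by rewrite mxtrace_mulC /mxtrace big_ord1. Qed.

(** Treats (nabla_a xi^{bB}) xi_b^C. The Clifford relation turns U_c L_a into - U_a L_c and a metric
    term; then [contract_LMU] applies to the rank-one matrix z^T x. *)
Lemma contract_grad a :
  contract (fun c b => (dx a *m U c)^T *m (x *m U b)) =
  (2 * s) *: (z^T *m (x *m U a) - (x *m U a)^T *m z - (x *m z^T) 0 0 *: U a).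
Proof.
have E c b : (dx a *m U c)^T *m (x *m U b) =
   s *: (2 *: (g c a *: (z^T *m (x *m U b)))) +
   s *: (U a *m (L c *m (z^T *m x) *m U b)).
  rewrite /dx -scalemxAl linearZ /= !trmx_mul U_skew L_skew -!scalemxAl.
  rewrite !(mulNmx, mulmxN) opprK scaleNr -scalerN.
  rewrite -scalerDr; congr (s *: _).
  have UL : U c *m L a = - 2 * g c a *: 1%:M - U a *m L c.
    by rewrite UL_swap scalemx1.
  rewrite !mulmxA UL mulmxBl -scalemxAl mul1mx !mulmxBl -!scalemxAl.
  by rewrite opprB -scalerA scaleNr opprK addrC.
rewrite (eq_contract _ E) contractD !contractZ contract_mull contract_LMU.
rewrite (contract_metric g_sym g_unit (fun b => z^T *m (x *m U b))).
rewrite tr_outer trmx_mul trmxK -scalemxAr mulmxBr (mulmxA (U a) x^T) mul_mx_scalar.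
have -> : U a *m x^T = - (x *m U a)^T by rewrite trmx_mul U_skew mulNmx opprK.
by rewrite mulNmx -!scalerDr scalerA mulrC addrA.
Qed.

(** The divergence nabla_b xi^{bB}: the factor is - s times the contraction - 6 of L_b U_d. *)
Lemma contract_div :
  contract (fun b d => dx b *m U d) = (6 * s) *: z.
Proof.
have E b d : dx b *m U d = - s *: (z *m (L b *m U d)).
  by rewrite -scalemxAl mulmxA.
rewrite (eq_contract _ E) contractZ contract_mull contract_LU mul_mx_scalar.
by rewrite scalerA; congr (_ *: _); ring.
Qed.

(** Treats xi^{bB} nabla_b xi_a^C. Here U_d and L_b enclose the rank-one matrix x^T z, so
    [contract_UML] applies directly. *)
Lemma contract_along a :
  contract (fun b d => (x *m U d)^T *m (dx b *m U a)) =
  (2 * s) *: (z^T *m (x *m U a) - (x *m z^T) 0 0 *: U a).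
Proof.
have E b d : (x *m U d)^T *m (dx b *m U a) =
    s *: (U d *m (x^T *m z) *m L b *m U a).
  rewrite /dx trmx_mul U_skew -scalemxAl -scalemxAr !mulNmx.
  by rewrite scalerN scaleNr opprK !mulmxA.
rewrite (eq_contract _ E) contractZ contract_mulr (contract_sym g_sym) contract_UML.
rewrite tr_outer trmx_mul trmxK -scalemxAl scalerA mulmxBl mul_scalar_mx !mulmxA.
rewrite [s * 2]mulrC; congr (_ *: (_ - _ *: _)).
by rewrite -{1}[z]trmxK -trmx_mul mxE.
Qed.

(** The scalar xi^{bA} nabla_b xi_A, in which U_d and L_b are adjacent. *)
Lemma contract_dot :
  contract (fun b d => (x *m U d) *m (dx b)^T) = (- 6 * s * (x *m z^T) 0 0)%:M.
Proof.
have E b d : x *m U d *m (dx b)^T = s *: (x *m (U d *m L b) *m z^T).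
  rewrite /dx linearZ /= trmx_mul L_skew -scalemxAr mulNmx mulmxN.
  by rewrite scaleNr scalerN opprK !mulmxA.
rewrite (eq_contract _ E) contractZ contract_mulr contract_mull.
rewrite (contract_sym g_sym) contract_UL mul_mx_scalar -scalemxAl.
rewrite [x *m z^T in LHS]mx11_scalar.
by rewrite !scale_scalar_mx; congr (_%:M); ring.
Qed.

Let h := invmx g.

Lemma outerE (v w : 'rV[F]_4) B D : (v^T *m w) B D = v 0 B * w 0 D.
Proof. by rewrite mxE big_ord1 mxE. Qed.

(** This and the next three lemmas restate the contractions entrywise, in the shape of the sums in
    the theorem. *)
Lemma grad_entry a B D :
  \sum_b (\sum_c h b c * (dx a *m U c) 0 B) * (x *m U b) 0 D =
  2 * s * (z 0 B * (x *m U a) 0 D - (x *m U a) 0 B * z 0 D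
           - (x *m z^T) 0 0 * U a B D).
Proof.
have /matrixP /(_ B D) := contract_grad a.
have subE (P Q S : 'M[F]_4) k :
    (k *: (P - Q - S)) B D = k * (P B D - Q B D - S B D).
  by rewrite !mxE.
rewrite subE !outerE [(_ *: U a) B D]mxE => <-; rewrite contractE exchange_big.
apply: eq_bigr => b _; rewrite mulr_suml; apply: eq_bigr => c _.
by rewrite outerE mulrA /h (invmx_sym g_sym).
Qed.

Lemma div_entry B : \sum_b \sum_c h b c * (dx b *m U c) 0 B = 6 * s * z 0 B.
Proof.
by have /matrixP /(_ 0 B) := contract_div; rewrite contractE [RHS]mxE.
Qed.

Lemma along_entry a B D :
  \sum_b (\sum_d h b d * (x *m U d) 0 B) * (dx b *m U a) 0 D =
  2 * s * (z 0 B * (x *m U a) 0 D - (x *m z^T) 0 0 * U a B D).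
Proof.
have /matrixP /(_ B D) := contract_along a.
have subE (P S : 'M[F]_4) k : (k *: (P - S)) B D = k * (P B D - S B D).
  by rewrite !mxE.
rewrite subE outerE [(_ *: U a) B D]mxE => <-; rewrite contractE.
apply: eq_bigr => b _; rewrite mulr_suml; apply: eq_bigr => c _.
by rewrite outerE mulrA.
Qed.

Lemma dot_entry :
  \sum_b \sum_A (\sum_d h b d * (x *m U d) 0 A) * dx b 0 A =
  - 6 * s * (x *m z^T) 0 0.
Proof.
have /matrixP /(_ 0 0) := contract_dot.
rewrite contractE [X in _ = X -> _]mxE mulr1n => <-; apply: eq_bigr => b _.
under eq_bigr => A _ do rewrite mulr_suml.
rewrite exchange_big; apply: eq_bigr => d _ /=.
rewrite mxE mulr_sumr; apply: eq_bigr => A _.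
by rewrite mulrA [(dx b)^T _ _]mxE.
Qed.

(** [contract_USU] applies because x^T x is symmetric. This is the purity of chiral spinors in
    dimension six. *)
Lemma null_entry A D :
  \sum_a (\sum_d h a d * (x *m U d) 0 A) * (x *m U a) 0 D = 0.
Proof.
have Ssym : (x^T *m x)^T = x^T *m x by rewrite trmx_mul trmxK.
have E d a : (x *m U d)^T *m (x *m U a) = - (U d *m (x^T *m x) *m U a).
  by rewrite trmx_mul U_skew !mulNmx !mulmxA.
have /matrixP /(_ A D) : contract (fun d a => (x *m U d)^T *m (x *m U a)) = 0.
  by rewrite (eq_contract _ E) contractN contract_USU // oppr0.
rewrite contractE [X in _ = X -> _]mxE => E0; apply: etrans E0.
rewrite exchange_big; apply: eq_bigr => d _ /=.
rewrite mulr_suml; apply: eq_bigr => a _.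
by rewrite outerE mulrA /h (invmx_sym g_sym d).
Qed.

(** The skewness [gamma_skew] in the middle indices, contracted with x in the first index. *)
Lemma sym_entry A B D :
  \sum_a (\sum_d h a d * (x *m U d) 0 A) * U a B D
  + \sum_a (\sum_d h a d * (x *m U d) 0 B) * U a A D = 0.
Proof.
rewrite -big_split /=.
transitivity (\sum_E x 0 E * \sum_d \sum_a h d a *
    (U d E A * U a B D + U d E B * U a A D)); last first.
  by rewrite big1 // => E _; rewrite gamma_skew mulr0.
under [RHS]eq_bigr => E _ do rewrite exchange_big mulr_sumr.
rewrite [RHS]exchange_big; apply: eq_bigr => a _ /=.
under [RHS]eq_bigr => E _ do rewrite mulr_sumr.
rewrite [RHS]exchange_big !mulr_suml -big_split; apply: eq_bigr => d _ /=.
rewrite !mxE !mulr_sumr !mulr_suml -big_split; apply: eq_bigr => E _ /=.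
by rewrite /h (invmx_sym g_sym a d); ring.
Qed.

End CoSpinor.

End ChiralClifford.

(** * Partial and covariant derivatives *)

Section DifferentiableFunctions.
Variables (K : numFieldType) (V : normedModType K) (x : V).

Lemma differentiable_bigsum (I : Type) (r : seq I) (f : I -> V -> K) :
  (forall i, differentiable (f i) x) ->
  differentiable (fun y => \sum_(i <- r) f i y) x.
Proof.
move=> df; elim: r => [|i r IHr].
  under eq_fun do rewrite big_nil; exact: differentiable_cst.
under eq_fun do rewrite big_cons; exact: differentiableD.
Qed.

Lemma differentiable_bigprod (I : Type) (r : seq I) (f : I -> V -> K) :
  (forall i, differentiable (f i) x) ->
  differentiable (fun y => \prod_(i <- r) f i y) x.
Proof.
move=> df; elim: r => [|i r IHr].
  under eq_fun do rewrite big_nil; exact: differentiable_cst.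
under eq_fun do rewrite big_cons; exact: differentiableM.
Qed.

Lemma differentiable_det n (M : V -> 'M[K]_n) :
  (forall i j, differentiable (fun y => M y i j) x) ->
  differentiable (fun y => \det (M y)) x.
Proof.
move=> dM; apply: differentiable_bigsum => s.
apply: differentiableM; first exact: differentiable_cst.
exact: differentiable_bigprod.
Qed.

(** Near [x] the inverse is the adjugate over the determinant. Invertibility is asked on a
    neighbourhood because [invmx] takes a default value on singular matrices. *)
Lemma derivable_invmx n (M : V -> 'M[K]_n) i j v :
  (forall k l, differentiable (fun y => M y k l) x) ->
  (\near x, M x \in unitmx) ->
  derivable (fun y => invmx (M y) i j) x v.
Proof.
move=> dM uM.
apply: (@near_eq_derivable _ _ _ (fun y => (\det (M y))^-1 * \adj (M y) i j)).
  by near=> y; rewrite /invmx ifT ?mxE //; near: y.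
apply/diff_derivable/differentiableM.
  apply: differentiableV; first exact: differentiable_det.
  by have := nbhs_singleton uM; rewrite unitmxE unitfE.
under eq_fun do rewrite mxE.
apply: differentiableM; first exact: differentiable_cst.
apply: differentiable_det => k l.
under eq_fun do rewrite !mxE.
exact: dM.
Unshelve. all: by end_near.
Qed.

End DifferentiableFunctions.

Section Partial.
Variables (R : realType) (n : nat) (a : 'I_n) (x : 'rV[Cplx R]_n).
Implicit Types f g : 'rV[Cplx R]_n -> Cplx R.
Let e : 'rV[Cplx R]_n := delta_mx 0 a.

Lemma partialM f g : derivable f x e -> derivable g x e ->
  partial a (fun y => f y * g y) x = partial a f x * g x + f x * partial a g x.
Proof.
by move=> df dg; rewrite /partial (deriveM df dg) addrC [_ *: _]mulrC.
Qed.

Lemma partial_sum m (f : 'I_m -> 'rV[Cplx R]_n -> Cplx R) :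
  (forall k, derivable (f k) x e) ->
  partial a (fun y => \sum_k f k y) x = \sum_k partial a (f k) x.
Proof. by move=> df; rewrite -(derive_sum df) /partial -fct_sumE. Qed.

Lemma eq_partial f g : (\near x, f x = g x) -> partial a f x = partial a g x.
Proof. exact: near_eq_derive. Qed.

Lemma partial_cst (c : Cplx R) : partial a (fun=> c) x = 0.
Proof. exact: derive_cst. Qed.

Lemma partial_mulmx m p q (M : 'rV[Cplx R]_n -> 'M[Cplx R]_(m, p))
    (N : 'rV[Cplx R]_n -> 'M[Cplx R]_(p, q)) i j :
  (forall k l, derivable (fun y => M y k l) x e) ->
  (forall k l, derivable (fun y => N y k l) x e) ->
  partial a (fun y => (M y *m N y) i j) x =
  ((\matrix_(k, l) partial a (fun y => M y k l) x) *m N x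
   + M x *m (\matrix_(k, l) partial a (fun y => N y k l) x)) i j.
Proof.
move=> dM dN; under [X in partial a X]eq_fun do rewrite mxE.
rewrite partial_sum => [|k]; last exact: derivableM.
rewrite !mxE -big_split; apply: eq_bigr => k _ /=.
by rewrite !mxE partialM.
Qed.

End Partial.

(** * Metricity, and covariant derivatives of xi_a^B and xi^{aB} *)

Section CovariantDerivatives.
Variables (R : realType) (G : spin_geometry R).
Hypothesis hG : is_spin_complex_riemannian G.
Variables (i : chart_label (base_manifold G)) (x : 'rV[Cplx R]_6).
Hypothesis ix : chart_image i x.

Local Notation C := (Cplx R).

Definition metric_mx (y : 'rV[C]_6) : 'M[C]_6 := \matrix_(a, b) metric i a b y.
Definition up_mx (a : 'I_6) (y : 'rV[C]_6) : 'M[C]_4 :=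
  \matrix_(A, B) gamma_up i a A B y.
Definition dn_mx (a : 'I_6) (y : 'rV[C]_6) : 'M[C]_4 :=
  \matrix_(A, B) gamma_dn i a A B y.
Definition conn_mx (a : 'I_6) : 'M[C]_4 := \matrix_(A, B) spin_conn i a A B x.
Definition christoffel_mx (a : 'I_6) : 'M[C]_6 :=
  \matrix_(b, c) christoffel i a b c x.

Lemma near_chart : \near x, chart_image i x.
Proof.
by apply: open_nbhs_nbhs; split=> //; exact: cm_image_open (scr_manifold hG) i.
Qed.

Lemma metric_mx_unit y : chart_image i y -> metric_mx y \in unitmx.
Proof. exact: hm_nondegenerate (scr_metric hG) i y. Qed.

Lemma metric_mx_sym y : chart_image i y -> (metric_mx y)^T = metric_mx y.
Proof.
by move=> iy; apply/matrixP => a b; rewrite !mxE (hm_sym (scr_metric hG)).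
Qed.

Lemma derivable_metric a b v : derivable (metric i a b) x v.
Proof. exact/diff_derivable/(hm_holomorphic (scr_metric hG)). Qed.

Lemma derivable_inv_metric a b v : derivable (inv_metric i a b) x v.
Proof.
apply: derivable_invmx => [k l|].
  under eq_fun do rewrite mxE; exact: (hm_holomorphic (scr_metric hG)).
by near=> y; apply: metric_mx_unit; near: y; exact: near_chart.
Unshelve. all: by end_near.
Qed.

(** Metricity of the Levi-Civita connection: in the sum of two Christoffel symbols of the first kind
    only the derivative in direction a survives. *)
Lemma partial_metric a b c :
  partial a (metric i b c) x =
  (christoffel_mx a *m metric_mx x + metric_mx x *m (christoffel_mx a)^T) b c.
Proof.
(* The metric is symmetric on the chart image only, which is open, so the equality holds near [x]
   and can be differentiated. *)
have pS d b' c' : partial d (metric i b' c') x = partial d (metric i c' b') x.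
  apply: eq_partial; near=> y; apply: (hm_sym (scr_metric hG)).
  by near: y; exact: near_chart.
have E b' c' : (christoffel_mx a *m metric_mx x) b' c' =
  2^-1 * (partial a (metric i b' c') x + partial b' (metric i a c') x
          - partial c' (metric i a b') x).
  rewrite mxE.
  transitivity (2^-1 * \sum_e (\sum_d metric_mx x c' d * inv_metric i d e x) *
     (partial a (metric i b' e) x + partial b' (metric i a e) x
     - partial e (metric i a b') x)).
    rewrite mulr_sumr; under [RHS]eq_bigr => e _ do rewrite mulr_suml mulr_sumr.
    rewrite exchange_big; apply: eq_bigr => d _ /=.
    rewrite mxE /christoffel mulr_sumr mulr_suml; apply: eq_bigr => e _.
    rewrite (symE d c' (metric_mx_sym ix)) mulrC -!mulrA mulrCA.
    by congr (_ * (_ * _)).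
  have E e : \sum_d metric_mx x c' d * inv_metric i d e x = (c' == e)%:R.
    by have /matrixP /(_ c' e) := mulmxV (metric_mx_unit ix); rewrite !mxE.
  congr (_ * _); rewrite (bigD1 c') //= E eqxx mul1r big1 ?addr0 // => e /negbTE.
  by rewrite E eq_sym => ->; rewrite mul0r.
rewrite mxE; have -> : (metric_mx x *m (christoffel_mx a)^T) b c =
    (christoffel_mx a *m metric_mx x) c b.
  by rewrite -{1}(metric_mx_sym ix) -trmx_mul mxE.
rewrite !E (pS a c b); move: (partial a _ x) (partial b _ x) (partial c _ x).
by move=> p q r; field.
Unshelve. all: by end_near.
Qed.

(** Differentiating h g = 1 gives dh = - h (dg) h, into which [partial_metric] is inserted. *)
Lemma partial_inv_metric a b c :
  partial a (inv_metric i b c) x =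
  - (invmx (metric_mx x) *m christoffel_mx a
     + (christoffel_mx a)^T *m invmx (metric_mx x)) b c.
Proof.
pose h := invmx (metric_mx x); pose g := metric_mx x.
pose dh := \matrix_(k, l) partial a (fun y => invmx (metric_mx y) k l) x.
pose dg := \matrix_(k, l) partial a (fun y => metric_mx y k l) x.
have dgE : dg = christoffel_mx a *m g + g *m (christoffel_mx a)^T.
  apply/matrixP => k l; rewrite mxE -partial_metric.
  by under eq_fun do rewrite mxE.
have dhg : dh *m g + h *m dg = 0.
  have dM k l : derivable (fun y => invmx (metric_mx y) k l) x (delta_mx 0 a).
    exact: derivable_inv_metric.
  have dN k l : derivable (fun y => metric_mx y k l) x (delta_mx 0 a).
    under eq_fun do rewrite mxE; exact: derivable_metric.
  apply/matrixP => k l; apply: etrans (esym (partial_mulmx k l dM dN)) _.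
  rewrite [RHS]mxE -(partial_cst a x (1%:M k l)); apply: eq_partial.
  near=> y; rewrite mulVmx //; apply: metric_mx_unit.
  by near: y; exact: near_chart.
have hg : h *m g = 1%:M by rewrite mulVmx // metric_mx_unit.
have gh : g *m h = 1%:M by rewrite mulmxV // metric_mx_unit.
have -> : partial a (inv_metric i b c) x = dh b c by rewrite mxE.
have -> : dh = - (h *m dg *m h).
  move/eqP: dhg; rewrite addr_eq0 => /eqP /(congr1 (mulmxr h)) /=.
  by rewrite -(mulmxA dh) gh mulmx1 mulNmx.
rewrite [LHS]mxE dgE mulmxDr mulmxDl !mulmxA hg mul1mx -(mulmxA _ g h) gh mulmx1.
by rewrite -/h.
Unshelve. all: by end_near.
Qed.

Section CoSpinorField.
Variable xi : 'I_4 -> 'rV[C]_6 -> C.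
Hypothesis xi_holo : forall A, differentiable (xi A) x.

Let d_mx (a : 'I_6) : 'rV[C]_4 := \row_A nabla_sd i xi a A x.
Let xi_mx : 'rV[C]_4 := \row_A xi A x.

Lemma xi_vdE b B : xi_vd i xi b B x = (xi_mx *m up_mx b x) 0 B.
Proof. by rewrite mxE; apply: eq_bigr => A _; rewrite !mxE. Qed.

Lemma derivable_up b A B v : derivable (gamma_up i b A B) x v.
Proof. exact/diff_derivable/(cl_up_holomorphic (scr_clifford hG)). Qed.

Lemma derivable_xi_vd b B v : derivable (xi_vd i xi b B) x v.
Proof.
apply/diff_derivable/differentiable_bigsum => A.
apply: differentiableM; first exact: xi_holo.
exact: (cl_up_holomorphic (scr_clifford hG)).
Qed.

(** The parallelism of gamma_b^{AB}, solved for its partial derivatives. *)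
Lemma partial_up a b :
  \matrix_(A, B) partial a (gamma_up i b A B) x =
  \sum_c christoffel i a b c x *: up_mx c x
  - (conn_mx a)^T *m up_mx b x - up_mx b x *m conn_mx a.
Proof.
apply/matrixP => A B; have := sp_up_parallel (scr_connection hG) a b A B ix.
rewrite /nabla_vd_su_su => /eqP; rewrite -addrA addr_eq0 subr_eq => /eqP E.
have sub2E (P Q S : 'M[C]_4) : (P - Q - S) A B = P A B - Q A B - S A B.
  by rewrite !mxE.
rewrite [LHS]mxE E sub2E summxE [LHS]addrC opprD addrA; congr (_ - _ - _).
- by apply: eq_bigr => c _; rewrite !mxE.
- by rewrite mxE; apply: eq_bigr => D _; rewrite !mxE.
- by rewrite mxE; apply: eq_bigr => D _; rewrite !mxE mulrC.
Qed.

(** As gamma is parallel, the Christoffel terms cancel, and the remaining spin connection terms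
    complete the partial derivative of xi to nabla_a xi. *)
Lemma nabla_xi_vd a b B :
  nabla_vd_su i (xi_vd i xi) a b B x = (d_mx a *m up_mx b x) 0 B.
Proof.
pose dxi : 'rV[C]_4 := \row_A partial a (xi A) x.
have dE : d_mx a = dxi - xi_mx *m (conn_mx a)^T.
  apply/rowP => A; rewrite !mxE; congr (_ - _).
  by apply: eq_bigr => D _; rewrite !mxE mulrC.
have pE : partial a (xi_vd i xi b B) x =
    (dxi *m up_mx b x +
     xi_mx *m (\matrix_(A, B) partial a (gamma_up i b A B) x)) 0 B.
  rewrite partial_sum => [|A]; last first.
    by apply: derivableM; [exact: diff_derivable|exact: derivable_up].
  rewrite !mxE -big_split; apply: eq_bigr => A _ /=.
  rewrite !mxE partialM //; [exact: diff_derivable|exact: derivable_up].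
rewrite /nabla_vd_su pE partial_up dE.
have -> : \sum_c christoffel i a b c x * xi_vd i xi c B x =
    (xi_mx *m \sum_c christoffel i a b c x *: up_mx c x) 0 B.
  rewrite mulmx_sumr summxE; apply: eq_bigr => c _.
  by rewrite -scalemxAr mxE xi_vdE.
have -> : \sum_D spin_conn i a D B x * xi_vd i xi b D x =
    (xi_mx *m up_mx b x *m conn_mx a) 0 B.
  rewrite [RHS]mxE; apply: eq_bigr => D _.
  by rewrite xi_vdE mulrC [conn_mx _ _ _]mxE.
rewrite !mulmxBr mulmxBl !mulmxA.
move: (xi_mx *m \sum_c _) (xi_mx *m _ *m up_mx b x) (_ *m conn_mx a) => P Q S.
by rewrite !mxE; ring.
Qed.

(** As the inverse metric is parallel, raising the index commutes with nabla_a. *)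
Lemma nabla_xi_vu a b B :
  nabla_vu_su i (xi_vu i xi) a b B x =
  \sum_c invmx (metric_mx x) b c * (d_mx a *m up_mx c x) 0 B.
Proof.
under eq_bigr => c _ do rewrite -nabla_xi_vd.
pose h := invmx (metric_mx x); pose W := christoffel_mx a.
(* Of the two terms of dh, the one with h W becomes the Christoffel term of the lower index, and the
   other cancels that of the upper index. *)
have pE : partial a (xi_vu i xi b B) x =
    \sum_c h b c * partial a (xi_vd i xi c B) x
    - \sum_d (h *m W) b d * xi_vd i xi d B x
    - \sum_c christoffel i a c b x * xi_vu i xi c B x.
  rewrite partial_sum => [|c]; last first.
    by apply: derivableM; [exact: derivable_inv_metric|exact: derivable_xi_vd].
  under eq_bigr => c _.
    rewrite partialM; [|exact: derivable_inv_metric|exact: derivable_xi_vd].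
    rewrite partial_inv_metric mxE opprD mulrDl !mulNr.
    rewrite -[inv_metric _ _ _ _]/(h b c).
  over.
  rewrite !big_split !sumrN /= addrC addrA; congr (_ - _ - _).
  under [RHS]eq_bigr => c _ do rewrite mulr_sumr.
  rewrite [RHS]exchange_big; apply: eq_bigr => d _ /=.
  rewrite mxE mulr_suml; apply: eq_bigr => c _.
  by rewrite mulrA [(christoffel_mx a)^T _ _]mxE [christoffel_mx a _ _]mxE.
rewrite /nabla_vu_su pE subrK /nabla_vd_su.
under [RHS]eq_bigr => c _ do rewrite mulrDr mulrBr.
rewrite big_split sumrB /=; congr (_ - _ + _).
  under [RHS]eq_bigr => c _ do rewrite mulr_sumr.
  rewrite [RHS]exchange_big; apply: eq_bigr => d _ /=.
  rewrite mxE mulr_suml; apply: eq_bigr => c _.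
  by rewrite mulrA [W _ _]mxE.
under [RHS]eq_bigr => c _ do rewrite mulr_sumr.
rewrite [RHS]exchange_big; apply: eq_bigr => D _ /=.
by rewrite mulr_sumr; apply: eq_bigr => c _; rewrite mulrCA.
Qed.

End CoSpinorField.

End CovariantDerivatives.

(** * Conformal Killing spinors *)

Section ConformalKilling.
Variables (R : realType) (G : spin_geometry R).
Hypothesis hG : is_spin_complex_riemannian G.
Variables (i : chart_label (base_manifold G)) (x : 'rV[Cplx R]_6).
Hypothesis ix : chart_image i x.
Variables (xi zeta : 'I_4 -> 'rV[Cplx R]_6 -> Cplx R).
Hypothesis xi_holo : forall A, differentiable (xi A) x.
Hypothesis killing : forall a A, nabla_sd i xi a A x
  + (sqrtC 2)^-1 * \sum_B gamma_dn i a B A x * zeta B x = 0.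

Let g := metric_mx i x.
Let U a := up_mx i a x.
Let L a := dn_mx i a x.
Let X : 'rV[Cplx R]_4 := \row_A xi A x.
Let Z : 'rV[Cplx R]_4 := \row_A zeta A x.
Let s : Cplx R := (sqrtC 2)^-1.

Let g_unit : g \in unitmx. Proof. exact: metric_mx_unit. Qed.
Let g_sym : g^T = g. Proof. exact: metric_mx_sym. Qed.

Let U_skew a : (U a)^T = - U a.
Proof.
by apply/matrixP => A B; rewrite !mxE (cl_up_skew (scr_clifford hG)).
Qed.

Let L_skew a : (L a)^T = - L a.
Proof.
by apply/matrixP => A B; rewrite !mxE (cl_dn_skew (scr_clifford hG)).
Qed.

Let clifford a b : U a *m L b + U b *m L a = (- 2 * g a b)%:M.
Proof.
apply/matrixP => A B.
have /(congr1 ( *%R 2)) := cl_clifford (scr_clifford hG) a b A B ix.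
rewrite mulrA mulfV ?pnatr_eq0 // mul1r big_split => E.
have -> : (- 2 * g a b)%:M A B = 2 * (- metric i a b x * (A == B)%:R).
  by rewrite !mxE -mulr_natr; ring.
rewrite -E mxE; congr (_ + _);
  by rewrite mxE; apply: eq_bigr => D _; rewrite !mxE.
Qed.

Let sdE a A : nabla_sd i xi a A x = (- s *: (Z *m L a)) 0 A.
Proof.
have /eqP := killing a A; rewrite addr_eq0 => /eqP ->.
rewrite [RHS]mxE mulNr [X in _ = - (_ * X)]mxE; congr (- (_ * _)).
by apply: eq_bigr => B _; rewrite !mxE mulrC.
Qed.

Let row_sdE a : \row_A nabla_sd i xi a A x = - s *: (Z *m L a).
Proof. by apply/rowP => A; rewrite [LHS]mxE sdE. Qed.

Let vdE a B : xi_vd i xi a B x = (X *m U a) 0 B.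
Proof. exact: xi_vdE. Qed.

Let vuE a B : xi_vu i xi a B x = \sum_b invmx g a b * (X *m U b) 0 B.
Proof. by apply: eq_bigr => b _; rewrite vdE. Qed.

Let gradE a B D :
  \sum_b nabla_vu_su i (xi_vu i xi) a b B x * xi_vd i xi b D x =
  2 * s * (Z 0 B * (X *m U a) 0 D - (X *m U a) 0 B * Z 0 D
           - (X *m Z^T) 0 0 * U a B D).
Proof.
rewrite -(grad_entry g_unit g_sym U_skew L_skew clifford).
by apply: eq_bigr => b _; rewrite (nabla_xi_vu hG ix xi_holo a b B) row_sdE vdE.
Qed.

(** Write y = x U_a and p = x z^T. In units of s, the four terms contribute 2, - 3, 1, 0 to z^B y^D
    - y^B z^D and - 2, 0, - 2, 4 to p U_a^{BD}; both sums vanish. *)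
Lemma killing_identity a B D :
  \sum_b nabla_vu_su i (xi_vu i xi) a b B x * xi_vd i xi b D x
  + (skew_part (fun B' D' => xi_vd i xi a B' x *
         \sum_b nabla_vu_su i (xi_vu i xi) b b D' x) B D
     + skew_part (fun B' D' => \sum_b xi_vu i xi b B' x *
         nabla_vd_su i (xi_vd i xi) b a D' x) B D)
  - 2 / 3 * (\sum_b \sum_A xi_vu i xi b A x * nabla_sd i xi b A x)
    * gamma_up i a B D x = 0.
Proof.
have divE B' : \sum_b nabla_vu_su i (xi_vu i xi) b b B' x = 6 * s * Z 0 B'.
  rewrite -(div_entry g_unit g_sym U_skew L_skew clifford).
  apply: eq_bigr => b _.
  by rewrite (nabla_xi_vu hG ix xi_holo b b B') row_sdE.
have alongE B' D' :
    \sum_b xi_vu i xi b B' x * nabla_vd_su i (xi_vd i xi) b a D' x =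
    2 * s * (Z 0 B' * (X *m U a) 0 D' - (X *m Z^T) 0 0 * U a B' D').
  rewrite -(along_entry g_unit g_sym U_skew L_skew clifford).
  apply: eq_bigr => b _; rewrite vuE.
  by rewrite (nabla_xi_vd hG ix xi_holo b a D') row_sdE.
have dotE : \sum_b \sum_A xi_vu i xi b A x * nabla_sd i xi b A x =
    - 6 * s * (X *m Z^T) 0 0.
  rewrite -(dot_entry g_unit g_sym L_skew clifford).
  by apply: eq_bigr => b _; apply: eq_bigr => A _; rewrite vuE sdE.
have -> : gamma_up i a B D x = U a B D by rewrite mxE.
rewrite /skew_part gradE !divE !alongE dotE !vdE (skewE D B (U_skew a)).
move: (Z 0 B) (Z 0 D) ((X *m U a) 0 B) ((X *m U a) 0 D) (U a B D) s.
by move: ((X *m Z^T) 0 0) => p zB zD yB yD u t; field.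
Qed.

Lemma killing_symmetric_identity A B D :
  sym_part (fun A' B' => \sum_a \sum_b xi_vu i xi a A' x *
     nabla_vu_su i (xi_vu i xi) a b B' x * xi_vd i xi b D x) A B = 0.
Proof.
pose w a A' := \sum_d invmx g a d * (X *m U d) 0 A'.
pose p := (X *m Z^T) 0 0.
(* In the expansion by [gradE], both terms containing x U_a vanish by [null_entry]; only the p U_a
   term is left for the symmetrisation, which [sym_entry] annihilates. *)
have E A' B' : \sum_a \sum_b xi_vu i xi a A' x *
     nabla_vu_su i (xi_vu i xi) a b B' x * xi_vd i xi b D x =
   - (2 * s * p) * \sum_a w a A' * U a B' D.
  transitivity (2 * s * Z 0 B' * (\sum_a w a A' * (X *m U a) 0 D)
      - 2 * s * Z 0 D * (\sum_a w a A' * (X *m U a) 0 B')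
      - 2 * s * p * \sum_a w a A' * U a B' D); last first.
    rewrite !(null_entry g_unit g_sym U_skew L_skew clifford).
    by rewrite !mulr0 subr0 sub0r mulNr.
  rewrite !mulr_sumr -!sumrB; apply: eq_bigr => a _.
  under eq_bigr => b _ do rewrite -mulrA.
  rewrite -mulr_sumr gradE vuE -/(w a A') -/p.
  move: (w a A') (Z 0 B') (Z 0 D) ((X *m U a) 0 B') ((X *m U a) 0 D) (U a B' D).
  by move: s p => s' p' v zB zD yB yD u; ring.
rewrite /sym_part !E -mulrDr.
by rewrite (sym_entry g_unit g_sym U_skew L_skew clifford) !mulr0.
Qed.

End ConformalKilling.

Theorem proposition5p23 (R : realType) (G : spin_geometry R)
    (hG : is_spin_complex_riemannian G)
    (xi : chart_label (base_manifold G) -> 'I_4 -> 'rV[Cplx R]_6 -> Cplx R)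
    (hxi : conformal_killing_spinor xi) :
  (forall (i : chart_label (base_manifold G)) (x : 'rV[Cplx R]_6), chart_image i x ->
   forall (a : 'I_6) (B D : 'I_4),
     \sum_b nabla_vu_su i (xi_vu i (xi i)) a b B x * xi_vd i (xi i) b D x
     + (skew_part (fun B' D' => xi_vd i (xi i) a B' x *
            \sum_b nabla_vu_su i (xi_vu i (xi i)) b b D' x) B D
        + skew_part (fun B' D' => \sum_b xi_vu i (xi i) b B' x *
            nabla_vd_su i (xi_vd i (xi i)) b a D' x) B D)
     - 2 / 3 * (\sum_b \sum_A xi_vu i (xi i) b A x * nabla_sd i (xi i) b A x)
       * gamma_up i a B D x = 0)
  /\
  (forall (i : chart_label (base_manifold G)) (x : 'rV[Cplx R]_6), chart_image i x ->
   forall A B D : 'I_4,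
     sym_part (fun A' B' => \sum_a \sum_b xi_vu i (xi i) a A' x *
         nabla_vu_su i (xi_vu i (xi i)) a b B' x * xi_vd i (xi i) b D x) A B
     = 0).
Proof.
have [[xi_holo _] [zeta _ killing]] := hxi.
split=> i x ix; [move=> a B D|move=> A B D].
  by apply: (killing_identity hG ix (zeta := zeta i)) => [A|c A];
    [exact: xi_holo|exact: killing].
by apply: (killing_symmetric_identity hG ix (zeta := zeta i)) => [A'|c A'];
  [exact: xi_holo|exact: killing].
Qed.
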